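(* For every real constant $c>0$ and every positive integer $N_0$, there exist an integer $N\ge N_0$ and a bipartite graph $G$ on $N$ vertices such that $G$ contains no cycle of length $10$ (i.e. $G$ is $C_{10}$-free), and every subgraph of $G$ with at least $c\,|E(G)|$ edges contains a cycle of length $8$ (a copy of $C_8$).
   Context: $C_m$ denotes the cycle of length $m$. A graph is $F$-free if it contains no subgraph isomorphic to $F$. *)

(* Defs.v *)
From mathcomp Require Import all_boot all_order all_algebra.
From mathcomp Require Import reals.
Set Implicit Arguments. Unset Strict Implicit. Unset Printing Implicit Defensive.

Section Graphs.
Variable V : finType.

Definition simple_graph (e : rel V) : Prop := symmetric e /\ irreflexive e.

Definition edges (e : rel V) : {set {set V}} :=
  [set [set x; y] | x in V, y in V & e x y].

Definition bipartite (e : rel V) : Prop :=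
  exists col : V -> bool, forall x y, e x y -> col x != col y.

Definition has_cycle_in (m : nat) (H : {set {set V}}) : Prop :=
  exists f : 'I_m -> V, injective f /\
    forall i : 'I_m, [set f i; f (ordS i)] \in H.

Definition cycle_free (m : nat) (e : rel V) : Prop :=
  ~ has_cycle_in m (edges e).
End Graphs.

(* Main.v *)
(** Take the incidence graph between the points of a grid T^I and its
    axis-parallel lines, with |I| >= 2 / c and T large.  A C10 is a closed walk of
    five nonzero axis-parallel steps, consecutive ones in distinct directions:
    each direction used occurs at least twice, so there are at most two of them,
    and two directions cannot alternate around a 5-cycle.  A subgraph with a
    proportion c of the edges keeps on average two lines at each point, hence for
    some directions i and j both lines at a positive proportion of the points;
    such a set of points contains the four corners of an (i, j)-rectangle, which
    is a C8. *)

Require Import Defs.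
From mathcomp Require Import all_boot all_order all_algebra.
From mathcomp Require Import reals boolp zify.
Import Order.TTheory GRing.Theory Num.Theory.
Local Open Scope ring_scope.

(** * Points and axis-parallel lines of the grid *)

Section Grid.
Local Open Scope nat_scope.
Variables (I T : finType) (o : T).
Local Notation point := {ffun I -> T}.

Definition upd (x : point) (i : I) (t : T) : point :=
  [ffun k => if k == i then t else x k].

(** A line is encoded by its direction and its point with [i]-th coordinate [o], so that the points
    of one line all give the same pair. *)
Definition line (i : I) (x : point) : I * point := (i, upd x i o).

Lemma upd_same x i t : upd x i t i = t.
Proof. by rewrite ffunE eqxx. Qed.

Lemma upd_other x i t k : k != i -> upd x i t k = x k.
Proof. by rewrite ffunE => /negbTE ->. Qed.

Lemma upd_upd x i s t : upd (upd x i s) i t = upd x i t.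
Proof. by apply/ffunP=> k; rewrite !ffunE; case: eqP. Qed.

Lemma updC x i j s t : i != j -> upd (upd x i s) j t = upd (upd x j t) i s.
Proof.
move=> ij; apply/ffunP=> k; rewrite !ffunE.
by case: eqP => // ->; rewrite eq_sym (negbTE ij).
Qed.

Lemma upd_id x i : upd x i (x i) = x.
Proof. by apply/ffunP=> k; rewrite !ffunE; case: eqP => // ->. Qed.

Lemma line_upd i x t : line i (upd x i t) = line i x.
Proof. by rewrite /line upd_upd. Qed.

Lemma upd_eq_off x y i s t k : upd x i s = upd y i t -> k != i -> x k = y k.
Proof. by move=> /ffunP/(_ k) E ki; rewrite !upd_other in E. Qed.

Lemma upd_eqE x y i s : upd x i s = upd y i s -> y = upd x i (y i).
Proof.
move=> E; apply/ffunP=> k; rewrite !ffunE; case: eqP => [->//|/eqP ki].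
by rewrite (upd_eq_off _ _ _ _ _ _ E ki).
Qed.

(** * Counting pairs of points and flags *)

(* In any fibre of size r one has k r <= k^2 + r (r - 1). *)
Lemma card_fibre_pairs (A B : finType) (g : A -> B) (S : {set A}) (k : nat) :
  k * #|S| <= k ^ 2 * #|g @: S| +
    #|[set p : A * A | [&& p.1 \in S, p.2 \in S, p.1 != p.2 & g p.1 == g p.2]]|.
Proof.
set Q := [set p | _].
pose r b := #|[set a in S | g a == b]|.
have -> : #|S| = \sum_(b in g @: S) r b.
  rewrite -sum1_card (partition_big_imset g) /=; apply: eq_bigr => b _.
  by rewrite /r -sum1_card; apply: eq_bigl => a; rewrite inE.
have -> : #|Q| = \sum_(b in g @: S) r b * (r b).-1.
  transitivity (\sum_(a in S) (r (g a)).-1).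
    rewrite -sum1_card.
    rewrite (partition_big (fun p : A * A => p.1) (mem S)) /=; last first.
      by move=> p; rewrite inE => /and4P[].
    apply: eq_bigr => a aS.
    have -> : (r (g a)).-1 = #|[set b in S | g b == g a] :\ a|.
      by rewrite /r (cardsD1 a [set b in S | g b == g a]) inE aS eqxx.
    rewrite sum1dep_card.
    rewrite -(card_imset (mem (_ :\ a)) (f := fun b => (a, b))); last by move=> b b' [].
    apply: eq_card => -[a1 b]; rewrite !inE /=.
    apply/idP/imsetP.
      move=> /andP[/and4P[h1 h2 h3 h4] /eqP e]; subst a1.
      by exists b => //; rewrite !inE h2 eq_sym h3 eq_sym h4.
    move=> [b']; rewrite !inE => /and3P[h1 h2 h3] [-> ->].
    by rewrite aS h2 eq_sym h1 eq_sym h3 eqxx.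
  rewrite (partition_big_imset g) /=; apply: eq_bigr => b _.
  rewrite (eq_bigr (fun=> (r b).-1)) => [|a /andP[_ /eqP ->]//].
  rewrite sum_nat_const; congr (_ * _); rewrite /r -sum1_card -sum1dep_card.
  by apply: eq_bigl => a; rewrite ?inE.
rewrite big_distrr /= -sum1_card big_distrr /= -big_split /=.
(* If [r b <= k] then [k * r b <= k ^ 2]; otherwise [(r b).-1 >= k]. *)
by apply: leq_sum => b _; nia.
Qed.

(** Lines of one direction are pairwise disjoint, and each has [#|T|] points. *)
Lemma card_lines i (S : {set point}) : #|line i @: S| * #|T| <= #|point|.
Proof.
rewrite -cardsT -cardsX.
have inj : {in setX (line i @: S) [set: T] &,
    injective (fun p : (I * point) * T => upd p.1.2 i p.2)}.
  move=> [a s] [b t]; rewrite !inE /= => /andP[/imsetP[x _ ->] _].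
  move=> /andP[/imsetP[y _ ->] _] /=; rewrite !upd_upd => E.
  have := congr1 (fun z : point => z i) E; rewrite !upd_same => st; subst t.
  have := congr1 (fun z => upd z i o) E; rewrite !upd_upd => E'.
  by rewrite /line E'.
by rewrite -(card_in_imset inj) max_card.
Qed.

Definition rectangle_free (i j : I) (S : {set point}) : Prop :=
  forall (x : point) (s t : T), s != x i -> t != x j ->
    x \in S -> upd x i s \in S -> upd x j t \in S ->
    upd (upd x i s) j t \in S -> False.

(* A pair x, y on an i-line is encoded by x with its j-th coordinate replaced
   by y i; two pairs with the same code span a rectangle. *)
Lemma card_rectangle_free i j (S : {set point}) k :
  i != j -> k ^ 2 <= #|T| -> rectangle_free i j S -> k * #|S| <= 2 * #|point|.
Proof.
move=> ij kT rf; apply: leq_trans (card_fibre_pairs _ _ (line i) S k) _.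
set Q := [set p | _].
have hL : k ^ 2 * #|line i @: S| <= #|point|.
  by apply: leq_trans (card_lines i S); rewrite mulnC leq_mul2l kT orbT.
suff hQ : #|Q| <= #|point| by rewrite mul2n -addnn leq_add.
have inj : {in Q &, injective (fun p : point * point => upd p.1 j (p.2 i))}.
  move=> [x y] [x' y']; rewrite !inE /=.
  move=> /and4P[xS yS xy /eqP[/upd_eqE ey]].
  move=> /and4P[xS' yS' xy' /eqP[/upd_eqE ey']] E.
  have := congr1 (fun z : point => z j) E; rewrite !upd_same => yy.
  have ex : x' = upd x j (x' j).
    by apply: (@upd_eqE _ _ _ o); rewrite -(upd_upd _ _ (y i)) E upd_upd.
  have [xx|xx] := eqVneq (x' j) (x j).
    have exx : x' = x by rewrite ex xx upd_id.
    by congr pair; rewrite ?exx // ey ey' exx yy.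
  (* Both pairs have the same code, so [x'] is [x] moved in direction [j] and [y'] is [y] moved by
     the same amount: the four points are corners. *)
  exfalso; apply: (rf x (y i) (x' j)) => //.
  - by apply: contra xy => /eqP h; rewrite ey h upd_id.
  - by rewrite -ey.
  - by rewrite -ex.
  - by rewrite updC // -ex yy -ey'.
by rewrite -(card_in_imset inj) max_card.
Qed.

(** [D] exceeds the number of points by at most the number of pairs of flags sharing a point. Sorted
    by their two directions, these pairs fall into [#|I| ^ 2] classes, each small by
    [card_rectangle_free]. *)
Lemma card_flags (D : {set point * I}) :
  (2 * #|I| ^ 2).+1 ^ 2 <= #|T| ->
  (forall i j, i != j ->
     rectangle_free i j [set x | ((x, i) \in D) && ((x, j) \in D)]) ->
  #|D| < 2 * #|point|.
Proof.
move=> hT rf; have := card_fibre_pairs _ _ fst D 1.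
set Q := [set p | _] => hD.
have im : #|[set p.1 | p in D]| <= #|point| by apply: max_card.
have P0 : 0 < #|point| by apply/card_gt0P; exists [ffun=> o].
(* With [k > 2 * #|I| ^ 2], the bound on [k * #|Q|] below forces [#|Q| < #|point|]. *)
pose k := (2 * #|I| ^ 2).+1.
have hDQ : #|D| <= #|point| + #|Q|.
  by rewrite -[#|D|]mul1n; apply: leq_trans hD _; rewrite mul1n leq_add2r.
suff hQ : k * #|Q| <= #|I| ^ 2 * (2 * #|point|).
  move: hDQ P0 hQ; rewrite {}/k; move: (_ ^ 2) #|D| #|Q| #|point|.
  by move=> e D' Q' P' hDQ P0 hQ; nia.
rewrite -sum1_card.
rewrite (partition_big (fun p : (point * I) * (point * I) => (p.1.2, p.2.2))
  predT) //= big_distrr /=.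
have -> : #|I| ^ 2 = #|{: I * I}| by rewrite card_prod.
rewrite -sum_nat_const; apply: leq_sum => -[i j] _.
rewrite sum1dep_card.
(* Distinct flags at one point have distinct directions, so the diagonal classes are empty. *)
have [<-|ij] := eqVneq i j.
  rewrite (_ : #|_| = 0) ?muln0 //; apply: eq_card0 => -[[x a] [y b]].
  rewrite !inE /=; apply/negP => /andP[/and4P[_ _ h /eqP e] /eqP[e1 e2]].
  by rewrite /= in e; subst y a b; rewrite eqxx in h.
apply: leq_trans (card_rectangle_free i j _ k ij hT (rf i j ij)).
rewrite leq_mul2l; apply/orP; right.
set R := (X in _ <= #|X|).
rewrite -(card_imset (mem R) (f := fun x => ((x, i), (x, j)))); last by move=> x y [].
apply: subset_leq_card; apply/subsetP => -[[x a] [y b]].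
rewrite !inE /= => /andP[/and4P[h1 h2 _ /eqP e] /eqP[e1 e2]].
rewrite /= in e; subst y a b.
by apply/imsetP; exists x => //; rewrite inE h1.
Qed.

(** * The incidence graph and its edges *)

Definition vertex : finType := (point + I * point)%type.

(** A pair [(i, y)] with [y i != o] encodes no line; it is an isolated vertex. *)
Definition incident (u v : vertex) : bool :=
  match u, v with
  | inl x, inr l => l == line l.1 x
  | inr l, inl x => l == line l.1 x
  | _, _ => false
  end.

Definition is_point (v : vertex) : bool := if v is inl _ then true else false.

Lemma incident_sym : symmetric incident.
Proof. by case=> [x|l] [y|m]. Qed.

Lemma incident_simple : simple_graph incident.
Proof. by split; [exact: incident_sym | case]. Qed.

Lemma incident_col u v : incident u v -> is_point u != is_point v.
Proof. by case: u v => [x|l] [y|m]. Qed.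

Lemma mem_edges u v : ([set u; v] \in edges incident) = incident u v.
Proof.
apply/imset2P/idP => [[a b _]|uv]; last by exists u v; rewrite ?inE.
rewrite inE => /= ab E.
have : a \in [set u; v] by rewrite E set21.
have : b \in [set u; v] by rewrite E set22.
have nab : a != b by apply/eqP=> e; move: (incident_col _ _ ab); rewrite e eqxx.
rewrite !inE => /orP[]/eqP eb /orP[]/eqP ea; subst a b; rewrite ?eqxx // in nab *.
by rewrite incident_sym.
Qed.

(** A point lies on one line per direction, so the edges are parametrised by pairs of a point and a
    direction. *)
Definition flag_edge (p : point * I) : {set vertex} :=
  [set inl p.1; inr (line p.2 p.1)].

Lemma flag_edge_inj : injective flag_edge.
Proof.
move=> [x i] [y j] /= E.
have : (inl x : vertex) \in flag_edge (y, j) by rewrite -E set21.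
have : (inr (line i x) : vertex) \in flag_edge (y, j) by rewrite -E set22.
by rewrite !inE => /orP[]/eqP // [-> _] /orP[]/eqP // [->].
Qed.

Lemma edges_incident : edges incident = flag_edge @: [set: point * I].
Proof.
apply/setP=> h; apply/idP/imsetP => [|[[x i] _ ->]]; last first.
  by rewrite mem_edges /=.
move=> /imset2P[[x|[i y]] [z|[j z]] _]; rewrite inE => //= /eqP e ->.
  by exists (x, j); rewrite ?inE // /flag_edge /= -e.
by exists (z, i); rewrite ?inE // /flag_edge /= -e setUC.
Qed.

(** * Absence of 10-cycles *)

Lemma incident_step x l y :
  incident (inl x) (inr l) -> incident (inr l) (inl y) -> x != y ->
  x l.1 != y l.1 /\ forall k, k != l.1 -> x k = y k.
Proof.
move=> /= /eqP -> /eqP /= [/esym E] xy; split; last first.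
  by move=> k; apply: (upd_eq_off _ _ _ _ _ _ (esym E)).
apply: contra xy => /eqP h; apply/eqP.
by rewrite (upd_eqE _ _ _ _ (esym E)) -h upd_id.
Qed.

Lemma incident_turn x l m :
  incident (inl x) (inr l) -> incident (inl x) (inr m) -> l != m -> l.1 != m.1.
Proof.
move=> /= /eqP -> /eqP -> /= /eqP h; apply/eqP => e; apply: h.
by rewrite e.
Qed.

(* Along a closed walk each direction used must be used twice, so five steps use
   at most two directions, which cannot alternate around an odd cycle. *)
Lemma no_pentagon (x : 'I_5 -> point) (l : 'I_5 -> I * point) :
  injective x -> injective l ->
  (forall i, incident (inl (x i)) (inr (l i))) ->
  (forall i, incident (inr (l i)) (inl (x (ordS i)))) -> False.
Proof.
move=> xI lI h1 h2.
have nS (i : 'I_5) : i != ordS i by case: i => -[|[|[|[|[|]]]]].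
have S1 i := incident_step _ _ _ (h1 i) (h2 i) (contra_neq (@xI _ _) (nS i)).
have S2 i : (l i).1 != (l (ordS i)).1.
  apply: incident_turn (h1 (ordS i)) (contra_neq (@lI _ _) (nS i)).
  by rewrite incident_sym; apply: h2.
have e5 (i : 'I_5) : ordS (ordS (ordS (ordS (ordS i)))) = i.
  by apply/val_inj; case: i => -[|[|[|[|[|]]]]].
(* The coordinate changed at step [i] must be restored by another step, and by [S2] neither
   neighbouring step touches it. *)
have ret i : (l i).1 = (l (ordS (ordS i))).1 \/
             (l i).1 = (l (ordS (ordS (ordS i)))).1.
  have [->|n2] := eqVneq (l i).1 (l (ordS (ordS i))).1; first by left.
  have [->|n3] := eqVneq (l i).1 (l (ordS (ordS (ordS i)))).1; first by right.
  have [/eqP n0 _] := S1 i; case: n0.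
  rewrite (S1 (ordS i)).2 // (S1 (ordS (ordS i))).2 //.
  rewrite (S1 (ordS (ordS (ordS i)))).2 //.
  rewrite (S1 (ordS (ordS (ordS (ordS i))))).2 ?e5 // eq_sym.
  by have := S2 (ordS (ordS (ordS (ordS i)))); rewrite e5.
pose i0 : 'I_5 := ord0; pose i1 := ordS i0; pose i2 := ordS i1.
pose i3 := ordS i2; pose i4 := ordS i3.
have e4 : ordS i4 = i0 by apply/val_inj.
move: (S2 i0) (S2 i1) (S2 i2) (S2 i3) (S2 i4) => /eqP n0 /eqP n1 /eqP n2 /eqP n3 /eqP n4.
move: (ret i0) (ret i1) (ret i2) (ret i3) (ret i4).
rewrite -/i1 -/i2 -/i3 -/i4 e4 -/i1 -/i2 -/i3 in n0 n1 n2 n3 n4 *.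
(* Steps with equal directions are never adjacent, so each direction occurs at most twice among the
   five; by [ret] it occurs at least twice. But five is odd. *)
by intuition congruence.
Qed.

(** The even positions give five points and the odd ones the lines joining them, as in
    [no_pentagon]. *)
Lemma alternating_decagon (g : 'I_10 -> vertex) :
  injective g -> (forall k, incident (g k) (g (ordS k))) ->
  (forall k : 'I_10, is_point (g k) = ~~ odd k) -> False.
Proof.
move=> gI ginc gpt.
pose ev (k : 'I_5) : 'I_10 := inord k.*2.
have evE (k : 'I_5) : ev k = k.*2 :> nat.
  by rewrite inordK //; case: k => -[|[|[|[|[|]]]]].
have odE (k : 'I_5) : ordS (ev k) = k.*2.+1 :> nat.
  by rewrite /= evE; case: k => -[|[|[|[|[|]]]]].
have ev_next k : ordS (ordS (ev k)) = ev (ordS k).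
  by apply/val_inj; rewrite /= !evE /=; case: k => -[|[|[|[|[|]]]]].
have hx (k : 'I_5) : exists x, g (ev k) = inl x.
  have := gpt (ev k); rewrite evE odd_double.
  by case: (g (ev k)) => // x _; exists x.
have hl (k : 'I_5) : exists l, g (ordS (ev k)) = inr l.
  have := gpt (ordS (ev k)); rewrite odE /= odd_double.
  by case: (g (ordS (ev k))) => // l _; exists l.
have [x xE] := fin_all_exists hx.
have [l lE] := fin_all_exists hl.
have evI : injective ev.
  by move=> k m /(congr1 val); rewrite /= !evE => /double_inj /val_inj.
apply: (no_pentagon x l).
- by move=> k m e; apply/evI/gI; rewrite !xE e.
- by move=> k m e; apply/evI/(@ordS_inj _)/gI; rewrite !lE e.
- by move=> k; rewrite -xE -lE.
- by move=> k; rewrite -xE -lE -ev_next.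
Qed.

Lemma incident_C10_free : cycle_free 10 incident.
Proof.
move=> [f [fI fE]].
have finc k : incident (f k) (f (ordS k)) by rewrite -mem_edges.
have alt k : is_point (f (ordS k)) = ~~ is_point (f k).
  by have := incident_col _ _ (finc k); do 2 case: (is_point _).
have oddS (k : 'I_10) : odd (ordS k) = ~~ odd k.
  by case: k => -[|[|[|[|[|[|[|[|[|[|]]]]]]]]]].
have par (k : 'I_10) : is_point (f k) = odd k (+) is_point (f ord0).
  case: k => m; elim: m => [|m IH] hm.
    by rewrite /=; congr (is_point (f _)); apply/val_inj.
  have e : Ordinal hm = ordS (Ordinal (ltnW hm)).
    by apply/val_inj; rewrite /= modn_small.
  by rewrite e alt IH oddS addNb.
case h0: (is_point (f ord0)).
  by apply: (alternating_decagon f) => // k; rewrite par h0 addbT.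
(* If the cycle starts at a line, rotating it by one puts the points at even positions. *)
apply: (alternating_decagon (fun k => f (ordS k))) => //.
  exact: inj_comp fI (@ordS_inj _).
by move=> k; rewrite par h0 addbF oddS.
Qed.

(** * 8-cycles in dense subgraphs *)

Lemma rectangle_C8 (H : {set {set vertex}}) i j (x : point) (s t : T) :
  i != j -> s != x i -> t != x j ->
  (forall y, y \in [:: x; upd x i s; upd x j t; upd (upd x i s) j t] ->
     (flag_edge (y, i) \in H) && (flag_edge (y, j) \in H)) ->
  has_cycle_in 8 H.
Proof.
move=> ij si tj hH.
pose a := x; pose b := upd x i s; pose c := upd b j t; pose d := upd x j t.
have ji : j != i by rewrite eq_sym.
have ai : a i != s by rewrite eq_sym.
have aj : a j != t by rewrite eq_sym.
have bi : b i = s by rewrite upd_same.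
have bj : b j = a j by rewrite upd_other.
have ci : c i = s by rewrite upd_other.
have cj : c j = t by rewrite upd_same.
have di : d i = a i by rewrite upd_other.
have dj : d j = t by rewrite upd_same.
have lab : line i b = line i a by rewrite line_upd.
have lbc : line j c = line j b by rewrite line_upd.
have lda : line j d = line j a by rewrite line_upd.
have lcd : line i c = line i d by rewrite /c /b updC // line_upd.
have neq (y z : point) k : y k != z k -> y != z by apply: contra => /eqP->.
have nl (y z : point) k k' : k != k' -> y k != z k -> line k' y != line k' z.
  move=> kk; apply: contra => /eqP[E]; apply/eqP; exact: upd_eq_off E kk.
(* Corners alternate with sides; each side is named after the corner before it, and [lab] to [lcd]
   rename it for the corner after it. *)
pose w : 8.-tuple vertex :=
  [tuple inl a; inr (line i a); inl b; inr (line j b);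
         inl c; inr (line i c); inl d; inr (line j d)].
have hw : uniq w.
  have eL y z : (inl y == inl z :> vertex) = (y == z) by [].
  have eR l m : (inr l == inr m :> vertex) = (l == m) by [].
  have eLR y l : (inl y == inr l :> vertex) = false by [].
  have eRL l y : (inr l == inl y :> vertex) = false by [].
  have nij y z : (line i y == line j z) = false.
    by rewrite xpair_eqE (negbTE ij).
  have nji y z : (line j y == line i z) = false.
    by rewrite xpair_eqE (negbTE ji).
  rewrite /= !inE !(eL, eR, eLR, eRL, nij, nji) !orbF /= andbT !negb_or.
  rewrite (neq a b i) ?bi // (neq a c i) ?ci // (neq a d j) ?dj //.
  rewrite (neq b c j) ?cj ?bj // (neq b d i) ?bi ?di 1?eq_sym //.
  rewrite (neq c d i) ?ci ?di 1?eq_sym //.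
  by rewrite (nl a c j i) ?cj // (nl b d i j) ?bi ?di // eq_sym.
exists (tnth w); split; first exact/tuple_uniqP.
have [[ha1 ha2] [hb1 hb2] [hc1 hc2] [hd1 hd2]] : 
  [/\ flag_edge (a, i) \in H /\ flag_edge (a, j) \in H,
      flag_edge (b, i) \in H /\ flag_edge (b, j) \in H,
      flag_edge (c, i) \in H /\ flag_edge (c, j) \in H &
      flag_edge (d, i) \in H /\ flag_edge (d, j) \in H].
  by split; apply/andP/hH; rewrite !inE eqxx ?orbT.
move=> k; rewrite (tnth_nth (inl a)) (tnth_nth (inl a)).
case: k => -[|[|[|[|[|[|[|[|]]]]]]]] //= _; rewrite ?[[set inr _; _]]setUC //.
- by rewrite -lab.
- by rewrite -lbc.
- by rewrite lcd.
- by rewrite lda.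
Qed.

(** The edges of [H] are too many flags for [card_flags], so some two directions admit a
    rectangle. *)
Lemma dense_C8 (H : {set {set vertex}}) :
  (2 * #|I| ^ 2).+1 ^ 2 <= #|T| -> H \subset edges incident ->
  2 * #|point| <= #|H| -> has_cycle_in 8 H.
Proof.
move=> hT; rewrite edges_incident => /subsetP sH hH.
pose D := flag_edge @^-1: H.
have DH : #|H| <= #|D|.
  rewrite -(card_imset (mem D) flag_edge_inj); apply: subset_leq_card.
  apply/subsetP => h hh; have /imsetP[p _ e] := sH h hh.
  by apply/imsetP; exists p; rewrite // inE -e.
apply: contrapT => noC; have := leq_trans hH DH; rewrite leqNgt => /negP; apply.
apply: card_flags => // i j ij x s t si tj; rewrite !inE => h1 h2 h3 h4.
apply: noC; apply: (rectangle_C8 _ i j x s t) => // y.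
by rewrite !inE => /or4P[]/eqP->.
Qed.

End Grid.

(** * Relabelling the vertices by ordinals, and the choice of parameters *)

Lemma has_cycle_imset (U V : finType) (f : U -> V) m (H : {set {set U}}) :
  injective f -> has_cycle_in m H ->
  has_cycle_in m [set f @: h | h : {set U} in H].
Proof.
move=> fI [g [gI gH]]; exists (f \o g); split; first exact: inj_comp.
by move=> i; rewrite /= -imset_set1 -(imset_set1 f) -imsetU imset_f.
Qed.

Lemma edges_relpre (U V : finType) (e : rel V) (f : U -> V) (g : V -> U) :
  cancel f g -> cancel g f ->
  edges e = [set f @: h | h : {set U} in edges (relpre f e)].
Proof.
move=> fK gK; apply/setP=> h; apply/imset2P/imsetP.
  move=> [x y _]; rewrite inE => xy ->.
  exists [set g x; g y]; last by rewrite imsetU !imset_set1 !gK.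
  by apply/imset2P; exists (g x) (g y); rewrite ?inE //= !gK.
move=> [h' /imset2P[x y _]]; rewrite inE => /= xy -> ->.
by exists (f x) (f y); rewrite ?inE // imsetU !imset_set1.
Qed.

Theorem theorem1p2 (R : realType) (c : R) (N0 : nat) :
  0 < c -> (0 < N0)%N ->
  exists (N : nat) (e : rel 'I_N),
    (N0 <= N)%N /\ simple_graph e /\ bipartite e /\ cycle_free 10 e /\
    forall H : {set {set 'I_N}},
      H \subset edges e ->
      c * (#|edges e|%:R) <= (#|H|%:R) ->
      has_cycle_in 8 H.
Proof.
move=> c0 N00.
(* [d] directions make all degrees of points equal to [d]; [c * d >= 2] then leaves at least two
   edges of [H] per point on average. *)
pose d := Num.bound (2 / c).
have dc : 2 <= c * d%:R.
  by rewrite -ler_pdivrMl // mulrC ltW // archi_boundP // divr_ge0 // ltW.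
(* The first summand is the grid size required by [dense_C8]; the second provides [N0] vertices. *)
pose n := ((2 * d ^ 2).+1 ^ 2 + N0)%N.
pose I := 'I_d; pose T := 'I_n.+1; pose o : T := ord0.
pose V := vertex I T; pose E := @incident I T o.
pose f : 'I_#|V| -> V := enum_val; pose g : V -> 'I_#|V| := enum_rank.
have fK : cancel f g := @enum_valK V.
have gK : cancel g f := @enum_rankK V.
have fI := can_inj fK; have gI := can_inj gK.
have EE := edges_relpre _ _ E f g fK gK.
exists #|V|, (relpre f E); split; [|split; [|split; [|split]]].
- have d0 : (0 < d)%N.
    by rewrite lt0n; apply/eqP=> e; move: dc; rewrite e mulr0 lern0.
  (* The constant points are distinct because [d > 0]; they already number [n.+1]. *)
  pose u (t : T) : V := inl [ffun=> t].
  have uI : injective u.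
    by move=> t t' [/ffunP/(_ (Ordinal d0))]; rewrite !ffunE.
  have := leq_card u uI; rewrite card_ord.
  by apply: leq_trans; rewrite /n; lia.
- have [sym irr] := incident_simple I T o.
  by split=> [x y|x] /=; [exact: sym | exact: irr].
- exists (@is_point I T \o f) => x y; exact: incident_col.
- move=> /(has_cycle_imset _ _ f _ _ fI); rewrite -EE; exact: incident_C10_free.
move=> H sH hH.
pose H' := [set f @: h | h : {set 'I_#|V|} in H].
have cf := imset_inj fI.
have cH : #|H'| = #|H| by rewrite card_imset.
have -> : H = [set g @: h | h : {set V} in H'].
  rewrite -imset_comp -[LHS]imset_id; apply: eq_imset => h /=.
  by rewrite -imset_comp -[LHS]imset_id; apply: eq_imset => x /=; rewrite fK.
apply: has_cycle_imset => //; apply: (dense_C8 I T o).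
- by rewrite !card_ord /n; lia.
- by rewrite -/E EE; apply: imsetS.
rewrite cH -(ler_nat R); apply: le_trans hH.
have -> : #|edges (relpre f E)| = (#|{ffun I -> T}| * d)%N.
  rewrite -(card_imset _ cf) -EE edges_incident card_imset; last exact: flag_edge_inj.
  by rewrite cardsT card_prod card_ord.
by rewrite !natrM mulrCA mulrC ler_wpM2l.
Qed.
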